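(* Let $S$ be a set of positive integers with $|S|\le 2$. Then there is a sequence $(x_n)_{n\ge 1}$ with each $x_n\in\{+1,-1\}$ such that $\left|\sum_{i=1}^{k} x_{is}\right|\le 1$ for every $s\in S$ and every integer $k\ge 1$.
   Context: For a sequence $(x_n)_{n\ge1}\in\{\pm1\}^{\mathbb{Z}^+}$, the partial sums $d(s,k)=\sum_{i=1}^k x_{is}$ are the sums along the homogeneous arithmetic progression $s,2s,3s,\dots$; ''2-coloring $\mathbb{N}$ with discrepancy 1 with respect to the homogeneous arithmetic progressions with skip sizes in $S$'' means choosing such a sequence with $|d(s,k)|\le 1$ for all $s\in S$, $k\ge1$. *)

(* Defs.v *)
From mathcomp Require Export all_boot all_order all_algebra.
From mathcomp Require Export finmap.

Set Implicit Arguments.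
Unset Strict Implicit.
Unset Printing Implicit Defensive.

Import GRing.Theory Num.Theory.
Local Open Scope ring_scope.

(* The partial sum d(s, k) of x along s, 2s, ..., ks. Only the values x n with
   n >= 1 matter when s >= 1, so a sequence indexed by the positive integers is
   represented by a function on nat whose value at 0 is irrelevant. *)
Definition hap_sum (x : nat -> int) (s k : nat) : int :=
  \sum_(1 <= i < k.+1) x (i * s)%N.

(* Main.v *)
Require Import Defs.

Import GRing.Theory Num.Theory.
Local Open Scope fset_scope.
Local Open Scope ring_scope.

(** A sequence of signs has discrepancy 1 along s, 2s, 3s, ... as soon as the
    entries at (2m+1)s and (2m+2)s cancel for every m.  For two skips a and b
    these constraints form two matchings, whose union is bipartite; a solution
    can be written down by comparing 2-adic valuations.  If a and b have the
    same valuation v, let n get the parity of n / 2^v.  If a has the larger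
    one, let the multiples of a alternate: no odd multiple of b is a multiple
    of a, so each pair (2m+1)b, (2m+2)b has a free first entry. *)

Definition pairs_cancel (x : nat -> int) (s : nat) : Prop :=
  forall m, x (m.*2.+1 * s)%N + x (m.*2.+2 * s)%N = 0.

(** Partial sums of even length vanish pair by pair, so one of odd length is its last term, a single
    sign. *)
Lemma hap_sum_pairs_cancel (x : nat -> int) (s k : nat) :
  (forall n, x n = 1 \/ x n = -1) -> pairs_cancel x s -> `|hap_sum x s k| <= 1.
Proof.
move=> x_sign x_pairs.
have sum_even m : hap_sum x s m.*2 = 0.
  elim: m => [|m IHm]; first by rewrite /hap_sum big_geq.
  rewrite /hap_sum doubleS big_nat_recr //= big_nat_recr //=.
  by rewrite -/(hap_sum x s m.*2) IHm add0r x_pairs.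
rewrite -(odd_double_half k); case: (odd k); last by rewrite sum_even normr0.
rewrite /hap_sum add1n big_nat_recr //= -/(hap_sum x s k./2.*2) sum_even add0r.
by case: (x_sign (k./2.*2.+1 * s)%N) => ->.
Qed.

Lemma sign_cases (n : nat) : (-1) ^+ n = 1 :> int \/ (-1) ^+ n = -1 :> int.
Proof. by rewrite -signr_odd; case: (odd n); [right | left]. Qed.

(** An odd factor leaves the 2-adic valuation of [b] unchanged, and a multiple of [a] needs a larger
    one. *)
Lemma odd_mul_dvdnF (a b j : nat) :
  (0 < b)%N -> (logn 2 b < logn 2 a)%N -> odd j -> (a %| j * b)%N = false.
Proof.
move=> b_gt0 lt_ba j_odd; apply/negP => a_dvd.
have j_gt0 : (0 < j)%N by case: j j_odd {a_dvd}.
have := dvdn_leq_log 2 (_ : 0 < j * b)%N a_dvd.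
rewrite muln_gt0 j_gt0 b_gt0 lognM // (logn_coprime (m := j)) ?coprime2n // add0n.
by move=> /(_ isT); rewrite leqNgt lt_ba.
Qed.

Lemma coloring_logn_lt (a b : nat) :
    (0 < a)%N -> (0 < b)%N -> (logn 2 b < logn 2 a)%N ->
  exists x : nat -> int,
    [/\ forall n, x n = 1 \/ x n = -1, pairs_cancel x a & pairs_cancel x b].
Proof.
move=> a_gt0 b_gt0 lt_ba.
(* The middle case looks ahead: when [n + b] is a multiple of [a], its sign is already fixed and [n]
   takes the opposite one. *)
exists (fun n => if (a %| n)%N then (-1) ^+ (n %/ a) else
  if (a %| n + b)%N then (-1) ^+ ((n + b) %/ a).+1 else (-1) ^+ (n %/ b)).
split=> [n | m | m].
- by case: ifP => _; [|case: ifP => _]; apply: sign_cases.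
- by rewrite !dvdn_mull // !mulnK // [in X in _ + X]exprS mulN1r subrr.
- rewrite !(addnC _ b) -!mulSn.
  rewrite (odd_mul_dvdnF a b m.*2.+1) //=; last by rewrite odd_double.
  (* The second entry of a [b]-pair never looks ahead, since the next multiple of [b] is again an
     odd one. So either it is a multiple of [a], or both entries get alternating signs from
     [n %/ b]. *)
  rewrite (odd_mul_dvdnF a b m.*2.+3) //=; last by rewrite negbK odd_double.
  case: ifP => _; first by rewrite exprS mulN1r addNr.
  by rewrite !mulnK // [in X in _ + X]exprS mulN1r subrr.
Qed.

Lemma coloring_logn_eq (a b : nat) :
    (0 < a)%N -> (0 < b)%N -> logn 2 a = logn 2 b ->
  exists x : nat -> int,
    [/\ forall n, x n = 1 \/ x n = -1, pairs_cancel x a & pairs_cancel x b].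
Proof.
move=> a_gt0 b_gt0 eq_ab.
have cancel_at s : (0 < s)%N -> logn 2 s = logn 2 a ->
    pairs_cancel (fun n => (-1) ^+ (n %/ 2 ^ logn 2 a)) s.
  move=> s_gt0 <- m; have [//|q q_odd s_eq] := @pfactor_coprime 2 s _ s_gt0.
  rewrite coprime2n in q_odd.
  (* As [q] is odd, [j * q] has the parity of [j], which differs at the two entries of a pair. *)
  have quot j : (j * s %/ 2 ^ logn 2 s)%N = (j * q)%N.
    by rewrite [X in (_ * X %/ _)%N]s_eq mulnA mulnK ?expn_gt0.
  rewrite !quot.
  rewrite -signr_odd -[X in _ + X]signr_odd !oddM /= odd_double q_odd /=.
  by rewrite addNr.
exists (fun n => (-1) ^+ (n %/ 2 ^ logn 2 a)).
by split=> [n | |]; [apply: sign_cases | apply: cancel_at | apply: cancel_at].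
Qed.

Lemma coloring_two_skips (a b : nat) :
    (0 < a)%N -> (0 < b)%N ->
  exists x : nat -> int,
    [/\ forall n, x n = 1 \/ x n = -1, pairs_cancel x a & pairs_cancel x b].
Proof.
move=> a_gt0 b_gt0; have [lt_ab|lt_ba|] := ltngtP (logn 2 a) (logn 2 b).
- by have [x [x_sign xb xa]] := coloring_logn_lt b a b_gt0 a_gt0 lt_ab; exists x.
- exact: coloring_logn_lt.
- exact: coloring_logn_eq.
Qed.

Theorem theorem1 (S : {fset nat})
    (S_pos : forall s : nat, s \in S -> (0 < s)%N)
    (S_card : (#|` S| <= 2)%N) :
  exists x : nat -> int,
    (forall n : nat, (1 <= n)%N -> x n = 1 \/ x n = -1) /\
    (forall s k : nat, s \in S -> (1 <= k)%N -> `|hap_sum x s k| <= 1).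
Proof.
(* Smaller sets are padded: the empty one with the skip 1 twice, a singleton by repeating its
   element. *)
have [a [b [a_gt0 b_gt0 S_ab]]] : exists a b : nat,
    [/\ (0 < a)%N, (0 < b)%N & forall s, s \in S -> s = a \/ s = b].
  have S_mem s : (s \in S) = (s \in enum_fset S) by [].
  move: S_card S_pos S_mem; case: (enum_fset S) => [|a [|b []]] //= _ S_pos S_mem.
  - by exists 1%N, 1%N; split=> // s; rewrite S_mem.
  - have a_gt0 : (0 < a)%N by rewrite S_pos // S_mem mem_head.
    by exists a, a; split=> // s; rewrite S_mem inE => /eqP; left.
  - exists a, b; split; try by rewrite S_pos // S_mem !inE eqxx ?orbT.
    by move=> s; rewrite S_mem !inE => /orP[] /eqP; [left | right].
have [x [x_sign xa xb]] := coloring_two_skips a b a_gt0 b_gt0.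
exists x; split=> [n _ | s k /S_ab s_ab _]; first exact: x_sign.
by apply: hap_sum_pairs_cancel => //; case: s_ab => ->.
Qed.
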